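(* Every planar $3$-tree has queue number at most $5$.
   Context: A planar $3$-tree is a triangulated plane graph $G$ with $n\ge 3$ vertices such that either $n=3$ and $G$ is a $3$-cycle, or $n>3$ and $G$ has a vertex whose deletion yields a planar $3$-tree with $n-1$ vertices. A $k$-queue layout of a graph $G$ consists of a linear order $\prec$ of the vertices of $G$ and a partition of the edges of $G$ into $k$ sets (queues) such that no two independent edges (edges sharing no endvertex) of the same queue are nested. Two edges $(s_1,t_1)$ and $(s_2,t_2)$ with $s_1\prec t_1$, $s_2\prec t_2$ are nested if $s_1\prec s_2\prec t_2\prec t_1$ or $s_2\prec s_1\prec t_1\prec t_2$. The queue number of $G$ is the minimum $k$ such that $G$ admits a $k$-queue layout. *)

(* Defs.v *)
From mathcomp Require Import all_boot all_fingroup.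
Set Implicit Arguments. Unset Strict Implicit. Unset Printing Implicit Defensive.

(* A graph on vertex set {0,...,n-1} is given by a symmetric relation
   [adj : rel nat] (only its restriction to vertices < n matters).
   Faces are recorded as triples of vertices. *)

Definition tri_adj (a b c : nat) : rel nat :=
  fun x y => [&& x != y, x \in [:: a; b; c] & y \in [:: a; b; c]].

Definition stack_adj (adj : rel nat) (n a b c : nat) : rel nat :=
  fun x y => [|| adj x y,
                 (x == n) && (y \in [:: a; b; c]) |
                 (y == n) && (x \in [:: a; b; c])].

(* [planar3tree n adj F] : the plane graph on {0..n-1} with edge relation
   [adj] is a planar 3-tree whose faces (as vertex triples) are listed in [F].
   Base: a 3-cycle, with its two faces (inner and outer).
   Step: the inverse of deleting a degree-3 vertex of a planar 3-tree,
   i.e. insert a new vertex n into a face (a,b,c) and join it to a,b,c;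
   the face (a,b,c) is replaced by the three faces (a,b,n),(b,c,n),(a,c,n). *)
Inductive planar3tree : nat -> rel nat -> seq (nat * nat * nat) -> Prop :=
| P3T_base : planar3tree 3 (tri_adj 0 1 2) [:: (0, 1, 2); (0, 1, 2)]
| P3T_stack n adj F a b c :
    planar3tree n adj F -> (a, b, c) \in F ->
    planar3tree n.+1 (stack_adj adj n a b c)
      ([:: (a, b, n); (b, c, n); (a, c, n)] ++ rem (a, b, c) F).

Definition nested n (pos : 'I_n -> nat) (s1 t1 s2 t2 : 'I_n) : Prop :=
  (pos s1 < pos s2 < pos t2) && (pos t2 < pos t1)
  \/ (pos s2 < pos s1 < pos t1) && (pos t1 < pos t2).

(* A k-queue layout of the graph ({0..n-1}, adj): a linear order of the
   vertices (a permutation [sigma], vertex v at position [sigma v]) and an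
   assignment [q] of each edge to one of k queues (well defined on unordered
   edges), such that no two independent edges of the same queue are nested. *)
Definition queue_layout (n k : nat) (adj : rel nat)
    (sigma : {perm 'I_n}) (q : 'I_n -> 'I_n -> 'I_k) : Prop :=
  (forall x y : 'I_n, adj x y -> q x y = q y x) /\
  (forall s1 t1 s2 t2 : 'I_n,
     adj s1 t1 -> adj s2 t2 ->
     sigma s1 < sigma t1 -> sigma s2 < sigma t2 ->
     uniq [:: s1; t1; s2; t2] ->
     q s1 t1 = q s2 t2 ->
     ~ nested (fun v => val (sigma v)) s1 t1 s2 t2).

Definition has_queue_layout (n k : nat) (adj : rel nat) : Prop :=
  exists (sigma : {perm 'I_n}) (q : 'I_n -> 'I_n -> 'I_k),
    @queue_layout n k adj sigma q.

Definition queue_number_le (n : nat) (adj : rel nat) (k : nat) : Prop :=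
  has_queue_layout n k adj.

(* Main.v *)
Require Import Defs.
From mathcomp Require Import all_boot all_fingroup.
From mathcomp Require Import order ssralg ssrnum ssrint zify.
Set Implicit Arguments. Unset Strict Implicit. Unset Printing Implicit Defensive.

(** Peel the graph into levels.  Every component D of a level is outerplanar and
    lies inside a triangular face of the previous level; order the levels one
    after the other and keep each D consecutive.  Inside D use layers such that
    every triangle of D meets exactly three consecutive layers k, k+1, k+2: a
    vertex stacked on an edge joining layers k, k+1 goes to layer k+2, and one
    stacked on an edge joining layers k, k+2 goes to layer k+1.  With a suitable
    order of the layers the edges of span 1 do not nest, nor do those of span 2,
    and the triangles of D form a chain: sorted triangles are comparable
    coordinatewise.  Placing the components of the next level in the order of
    this chain, the edges to the first corners of the triangles do not nest,
    and likewise for the second and the third corners.  This gives 2 + 3 queues.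

    The orders are made explicit by embedding the graph into one universal
    infinite ordered structure in which every face has a reserved key for the
    vertex to be stacked into it. *)

(** * Keys and their order *)

Definition strict_total (T : eqType) (lt : rel T) :=
  [/\ irreflexive lt, transitive lt & forall x y, x != y -> lt x y || lt y x].

Definition lexprod (T1 T2 : eqType) (lt1 : rel T1) (lt2 : rel T2) : rel (T1 * T2) :=
  fun u v => lt1 u.1 v.1 || (u.1 == v.1) && lt2 u.2 v.2.

(** Addresses list the root end last, so comparing tails first is the lexicographic order read from
    the root. Sequences of different lengths are incomparable. *)
Fixpoint colex (T : eqType) (lt : rel T) (s t : seq T) : bool :=
  match s, t with
  | x :: s', y :: t' => colex lt s' t' || (s' == t') && lt x y
  | _, _ => false
  end.

Definition shortlex (T : eqType) (lt : rel T) : rel (seq T) :=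
  fun s t => (size s < size t) || (size s == size t) && colex lt s t.

Lemma strict_total_lexprod (T1 T2 : eqType) (lt1 : rel T1) (lt2 : rel T2) :
  strict_total lt1 -> strict_total lt2 -> strict_total (lexprod lt1 lt2).
Proof.
move=> [irr1 tr1 tot1] [irr2 tr2 tot2]; split.
- by move=> [x y]; rewrite /lexprod /= irr1 irr2 andbF.
- move=> [y1 y2] [x1 x2] [z1 z2]; rewrite /lexprod /=.
  case/orP=> [xy | /andP[/eqP-> xy]]; case/orP=> [yz | /andP[/eqP<- yz]].
  + by rewrite (tr1 _ _ _ xy yz).
  + by rewrite xy.
  + by rewrite yz.
  + by rewrite eqxx (tr2 _ _ _ xy yz) orbT.
- move=> [x1 x2] [y1 y2]; rewrite xpair_eqE negb_and /lexprod /= eq_sym.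
  case: (eqVneq y1 x1) => [-> /= /tot2/orP[]-> | /tot1/orP[]->]; by rewrite ?orbT.
Qed.

Lemma colex_irr (T : eqType) (lt : rel T) : irreflexive lt -> irreflexive (colex lt).
Proof. by move=> irr; elim=> //= x s ->; rewrite irr andbF. Qed.

Lemma colex_trans (T : eqType) (lt : rel T) : transitive lt -> transitive (colex lt).
Proof.
move=> tr; elim=> [|y t IH] [|x s] [|z u] //=.
case/orP=> [xy | /andP[/eqP-> xy]]; case/orP=> [yz | /andP[/eqP<- yz]].
- by rewrite (IH _ _ xy yz).
- by rewrite xy.
- by rewrite yz.
- by rewrite eqxx (tr _ _ _ xy yz) orbT.
Qed.

Lemma colex_total (T : eqType) (lt : rel T) :
  (forall x y, x != y -> lt x y || lt y x) ->
  forall s t, size s = size t -> s != t -> colex lt s t || colex lt t s.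
Proof.
move=> tot; elim=> [|x s IH] [|y t] //= [st]; rewrite eqseq_cons negb_and orbC eq_sym.
case: (eqVneq t s) => [-> /= /tot/orP[]-> | ts _]; rewrite ?orbT //.
by case/orP: (IH t st (negbT (introF eqP (fun e => negP ts (introT eqP (esym e))))))=> ->; rewrite ?orbT.
Qed.

Lemma strict_total_shortlex (T : eqType) (lt : rel T) :
  strict_total lt -> strict_total (shortlex lt).
Proof.
move=> [irr tr tot]; split.
- by move=> s; rewrite /shortlex ltnn (colex_irr irr) andbF.
- move=> t s u; rewrite /shortlex.
  case/orP=> [st | /andP[/eqP-> st]]; case/orP=> [tu | /andP[/eqP<- tu]].
  + by rewrite (ltn_trans st tu).
  + by rewrite st.
  + by rewrite tu.
  + by rewrite eqxx (colex_trans tr st tu) orbT.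
- move=> s t st; rewrite /shortlex.
  case: (ltngtP (size s) (size t)) => //= e.
  exact: colex_total.
Qed.

(* An address lists the path from the root of its component, last entry first;
   its length is the layer.  A context [(q, s) :: c] is the triangle with corners
   [q], [nb s (behead q)] and [behead (behead q)] in context [c], whose size is the
   level.  Vertex 0 has the key [([::], [::])], and all three corners of the
   degenerate triangle [([::], false)] denote it. *)
Definition entry : Type := (nat * int)%type.
Definition addr : Type := seq entry.
Definition ctx : Type := seq (addr * bool).
Definition key : Type := (ctx * addr)%type.

Definition elt : rel entry := lexprod ltn (fun i j : int => (i < j)%R).
Definition alt : rel addr := shortlex elt.
(** At equal level the parent components are compared first, then the triangles by [q] and the flag:
    this is the chain order on the triangles of a component. *)
Definition clt : rel ctx := shortlex (lexprod alt (fun a b : bool => ~~ a && b)).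
Definition klt : rel key := lexprod clt alt.

Lemma elt_strict_total : strict_total elt.
Proof.
apply: strict_total_lexprod; split=> [x|y x z|x y]; lia.
Qed.

Lemma alt_strict_total : strict_total alt.
Proof. exact/strict_total_shortlex/elt_strict_total. Qed.

Lemma klt_strict_total : strict_total klt.
Proof.
apply: strict_total_lexprod alt_strict_total.
apply/strict_total_shortlex/strict_total_lexprod; first exact: alt_strict_total.
by split=> [b | b1 b2 b3 | b1 b2]; lia.
Qed.

(** * Addresses of vertices inside a component *)

(* The children of a vertex are listed in five runs: the entry [(p, i)] is place
   [i] of run [p].  Even places hold vertices; an odd place is a gap, whose only
   child is the vertex of the next layer adjacent to both neighbours of the gap.
   Run 0 starts next to the vertex in the gap on the left, run 4 ends next to the
   vertex in the gap on the right, and runs 1, 2, 3 grow both ways from place 0. *)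
Definition isgap (a : addr) : bool := if a is e :: _ then odd `|e.2|%N else false.

Definition okentry (a : addr) (e : entry) : bool :=
  [&& e.1 <= 4, (e.1 == 0) ==> (1 <= e.2)%R, (e.1 == 4) ==> (e.2 <= -1)%R
    & (a == [::]) ==> (0 < e.1 < 4)].

Definition mid : entry := (2, 0%R).

Fixpoint okaddr (a : addr) : bool :=
  if a is e :: a' then okaddr a' && (if isgap a' then e == mid else okentry a' e)
  else true.

(** The outermost child of a vertex on side [s]. Its place is odd, so it is a gap; it faces the
    [mid] child of the adjacent gap. *)
Definition bdry (s : bool) : entry := if s then (4, (-1)%R) else (0, 1%R).

Definition step (s : bool) (e : entry) : entry :=
  (e.1, if s then (e.2 + 1)%R else (e.2 - 1)%R).

(* The position immediately before ([s = false]) or after ([s = true]) a position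
   of the same layer. *)
Fixpoint nb (s : bool) (a : addr) : addr :=
  if a is e :: a' then
    if isgap a' then bdry (~~ s) :: nb s a'
    else if e == bdry s then mid :: nb s a'
    else step s e :: a'
  else [::].

Lemma size_nb s a : size (nb s a) = size a.
Proof. by elim: a => //= e a IH; case: ifP => _ /=; rewrite ?IH //; case: ifP => _ /=; rewrite ?IH. Qed.

(** Children of the root only use runs 1 to 3, so layers are unbounded on both sides and [nb] never
    has to move sideways from the root. *)
Lemma bdry_root s a : okaddr (bdry s :: a) -> isgap a = false -> a != [::].
Proof. by case: a => //; case: s. Qed.

(** Within a run the parity of the place changes; between two parents one side is [mid], a vertex,
    and the other a [bdry] entry, a gap. *)
Lemma isgap_nb s a : okaddr a -> a != [::] -> isgap (nb s a) = ~~ isgap a.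
Proof.
case: a => //= e a /andP[_]; case: ifP => [_ /eqP-> _ | _ _ _]; first by case: s.
case: (e =P bdry s) => [->|_]; first by case: s.
by case: e => p i; case: s => /=; lia.
Qed.

Lemma nbK s a : okaddr a -> nb (~~ s) (nb s a) = a.
Proof.
elim: a => //= e a IH /andP[oka]; have {IH}:= IH oka; case: ifP => [ga IH /eqP-> | ga IH oke].
  have na: a != [::] by case: (a) ga.
  by rewrite /= isgap_nb // ga /= eqxx IH.
case: (e =P bdry s) => [def_e|ne] /=.
  have na: a != [::] by apply: (@bdry_root s); rewrite //= oka ga -def_e.
  by rewrite isgap_nb // ga /= IH negbK def_e.
rewrite ga; case: e oke ne => p i; rewrite /okentry /step /bdry /= => /and4P[_ l0 l4 _] ne.
case: s {IH} ne => /= ne; case: eqP => [[pE iE]|_].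
- by move: l0; rewrite pE /=; lia.
- by rewrite /step /=; congr ((_, _) :: _); lia.
- by move: l4; rewrite pE /=; lia.
- by rewrite /step /=; congr ((_, _) :: _); lia.
Qed.

Lemma okaddr_nb s a : okaddr a -> okaddr (nb s a).
Proof.
elim: a => //= e a IH /andP[oka]; have {IH}okn := IH oka; case: ifP => [ga _ | ga oke] /=.
  have na: a != [::] by case: (a) ga.
  rewrite okn isgap_nb // ga /=.
  have nn: nb s a != [::] by rewrite -size_eq0 size_nb size_eq0.
  by rewrite /okentry (negbTE nn); case: s {okn nn}.
case: (e =P bdry s) => [def_e|ne] /=.
  have na: a != [::] by apply: (@bdry_root s); rewrite //= oka ga -def_e.
  by rewrite okn isgap_nb // ga /=.
rewrite oka ga; move/eqP: ne; case: e oke => p i; rewrite /okentry /step /bdry.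
by case: s {okn} => /=; rewrite xpair_eqE; case: (a == [::]); lia.
Qed.

(** * Neighbouring positions in a layer *)

Definition aside (s : bool) (a b : addr) : bool :=
  if s then colex elt a b else colex elt b a.

Lemma aside_cons s e a e' a' :
  aside s (e :: a) (e' :: a') =
  aside s a a' || (a == a') && (if s then elt e e' else elt e' e).
Proof. by case: s => //=; rewrite eq_sym. Qed.

Lemma nb_aside s a : okaddr a -> a != [::] -> aside s a (nb s a).
Proof.
elim: a => //= e a IH /andP[oka]; have {IH}IH := IH oka; case: ifP => [ga _ _|ga oke _].
  by rewrite aside_cons IH //; case: (a) ga.
case: (e =P bdry s) => [def_e|ne].
  by rewrite aside_cons IH // (@bdry_root s) //= oka ga -def_e.
rewrite aside_cons eqxx orbC; case: e {oke ne} => p i; rewrite /elt /lexprod /=.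
clear; case: s; lia.
Qed.

(** Places of a run are consecutive integers. For different parents the essential case is that of
    adjacent ones: exactly one is a gap, and its [mid] child meets a [bdry] child of the other. *)
Lemma nb_extremal s a b : okaddr a -> okaddr b -> size b = size a ->
  aside s a b -> (b == nb s a) || aside s (nb s a) b.
Proof.
elim: a b => [|e a IH] [|e' b] //=.
case/andP=> oka oke /andP[okb oke'] [szb]; rewrite aside_cons.
case/orP=> [ab | /andP[/eqP def_b ee']]; last first.
  subst b; clear IH; case: ifP oke oke' ee' => [ga /eqP-> /eqP-> | ga].
    by rewrite /elt /lexprod /mid /=; clear; case: s; lia.
  case: (e =P bdry s) => [->|/eqP ne] oke oke' ee'.
    by move: oke' ee'; clear; case: e' => p i; rewrite /okentry /elt /lexprod; case: s => /=; lia.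
  rewrite aside_cons eqseq_cons !eqxx andbT /= orbC.
  move: oke oke' ee' ne; clear; case: e e' => [p i] [p' i']; rewrite /okentry /elt /lexprod /step.
  by case: s => /=; rewrite !xpair_eqE; lia.
have {}IH := IH b oka okb szb ab.
move: IH; case: ifP oke => [ga _ | ga oke].
  have na: a != [::] by case: (a) ga.
  have gn: isgap (nb s a) = false by rewrite isgap_nb // ga.
  case/orP=> [/eqP def_b | ]; last by rewrite aside_cons => ->; rewrite orbT.
  rewrite def_b aside_cons eqseq_cons !eqxx andbT /=; move: oke'; rewrite def_b gn; clear.
  case: e' => p i; rewrite /okentry /elt /lexprod.
  by case: s => /=; rewrite xpair_eqE; case: (_ == [::]); lia.
case: (e =P bdry s) => [def_e | ne].
  have na: a != [::] by apply: (@bdry_root s); rewrite //= oka ga -def_e.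
  case/orP=> [/eqP def_b | ]; last by rewrite aside_cons => ->; rewrite orbT.
  by move: oke'; rewrite def_b isgap_nb // ga /= => /eqP->; rewrite eqxx.
by rewrite aside_cons ab orbT.
Qed.

Lemma colex_elt_trans : transitive (colex elt).
Proof. by case: elt_strict_total => _ tr _; apply: colex_trans. Qed.

Definition cole (a b : addr) : bool := (a == b) || colex elt a b.

Lemma cole_trans : transitive cole.
Proof.
move=> b a c; rewrite /cole => /orP[/eqP-> // | ab] /orP[/eqP<- | bc].
  by rewrite ab orbT.
by rewrite (colex_elt_trans ab bc) orbT.
Qed.

(* The possible lower ends of a span 1 edge whose upper end is a child of [h]. *)
Definition around (h a : addr) : Prop :=
  if isgap h then a = nb false h \/ a = nb true h else a = h.

Lemma around_le h a : okaddr h -> around h a -> cole (nb false h) a /\ cole a (nb true h).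
Proof.
move=> okh; rewrite /around /cole.
have [->|nh] := eqVneq h [::]; first by move=> /= ->.
have lo := nb_aside false okh nh; have hi := nb_aside true okh nh.
have lohi := colex_elt_trans lo hi.
case: ifP => _; first by case=> ->; rewrite eqxx lohi ?orbT.
by move->; rewrite /aside in lo hi; rewrite lo hi !orbT.
Qed.

(** A vertex is its own only lower end. Two gaps of a layer are never adjacent, so the right
    neighbour of the left gap is at most the left neighbour of the right gap. *)
Lemma around_mono h h' a a' : okaddr h -> okaddr h' -> size h' = size h ->
  colex elt h' h -> around h a -> around h' a' -> cole a' a.
Proof.
move=> okh okh' sz lt_h ha ha'.
have [lo _] := around_le okh ha; have [_ hi] := around_le okh' ha'.
have nh: h != [::] by case: (h) lt_h => //; case: (h').
have nh': h' != [::] by rewrite -size_eq0 sz size_eq0.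
have pr : cole h' (nb false h) := nb_extremal (s := false) okh okh' sz lt_h.
have su : cole (nb true h') h.
  by rewrite /cole eq_sym; apply: (nb_extremal (s := true)).
case g': (isgap h'); case g: (isgap h).
- apply: cole_trans hi (cole_trans _ lo); case/orP: pr => [/eqP e | lt_h'].
    by move: g'; rewrite e isgap_nb // g.
  have := nb_extremal (s := true) okh' (okaddr_nb false okh) _ lt_h'.
  by rewrite size_nb sz /cole eq_sym; apply.
- by move: ha; rewrite /around g => ->; apply: cole_trans hi su.
- by move: ha'; rewrite /around g' => ->; apply: cole_trans pr lo.
- by move: ha ha'; rewrite /around g g' => -> ->; rewrite /cole lt_h orbT.
Qed.

(** * Links of the universal structure do not nest *)

Definition kctx (u : key) : ctx := u.1.
Definition kaddr (u : key) : addr := u.2.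

Definition corner (q : addr) (s : bool) (a : addr) : Prop :=
  [\/ a = q, a = nb s (behead q) | a = behead (behead q)].

(** Span 1 is given by [around]; span 2 joins a vertex below a gap to the parent of that gap. *)
Definition same_ctx_link (u v : key) : Prop :=
  [/\ (kctx u) = (kctx v), (kaddr v) != [::]
    & around (behead (kaddr v)) (kaddr u) \/ isgap (behead (kaddr v)) /\ (kaddr u) = behead (behead (kaddr v))].

Definition cross_link (u v : key) : Prop :=
  exists q s, (kctx v) = (q, s) :: (kctx u) /\ corner q s (kaddr u).

Definition link (u v : key) : Prop := same_ctx_link u v \/ cross_link u v.

(** Queues 0 and 1 hold spans 1 and 2; queues 2, 3, 4 hold the three corners of a triangle, told
    apart by their layers. The last 0 is a default: the upper end of a cross link has a nonempty
    context. *)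
Definition color (u v : key) : nat :=
  if (kctx u) == (kctx v) then (size (kaddr v) - size (kaddr u)).-1
  else if (kctx v) is x :: _ then 2 + (size x.1 - size (kaddr u)) else 0.

Definition okctx (c : ctx) : bool :=
  all (fun x : addr * bool => okaddr x.1 && ((x.1 == [::]) || isgap (behead x.1))) c.

Definition okkey (u : key) : bool := okctx (kctx u) && okaddr (kaddr u).

Lemma altE (a b : addr) :
  alt a b = (size a < size b) || ((size a == size b) && colex elt a b).
Proof. by []. Qed.

Lemma kltE (u v : key) : klt u v = clt (kctx u) (kctx v) || (((kctx u) == (kctx v)) && alt (kaddr u) (kaddr v)).
Proof. by []. Qed.

Lemma size_around h a : around h a -> size a = size h.
Proof. by rewrite /around; case: ifP => _; [case=> ->; rewrite size_nb | move->]. Qed.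

Lemma isgap_cons a : isgap a -> {e & {b | a = e :: b}}.
Proof. by case: a => // e b _; exists e, b. Qed.

Lemma size_link_same u v : same_ctx_link u v ->
  around (behead (kaddr v)) (kaddr u) /\ size (kaddr v) = (size (kaddr u)).+1
  \/ [/\ isgap (behead (kaddr v)), (kaddr u) = behead (behead (kaddr v)) & size (kaddr v) = (size (kaddr u)).+2].
Proof.
case=> _ nv [ar|[g ->]].
  by left; split=> //; rewrite (size_around ar); case: (kaddr v) nv.
by right; split=> //; case: (kaddr v) nv g => //= e a _ /isgap_cons[e' [b ->]].
Qed.

(** Makes the colour of a cross link determine the corner; in the degenerate triangle all corners
    coincide. *)
Lemma corner_size q s a : corner q s a -> (q == [::]) || isgap (behead q) ->
  [\/ a = q /\ size q - size a = 0,
      a = nb s (behead q) /\ size q - size a = (q != [::])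
    | a = behead (behead q) /\ size q - size a = (q != [::]).*2].
Proof.
rewrite /corner; case: q => [|e q] /=; first by case=> ->; constructor 1.
move=> ca /isgap_cons[e' [b def_q]].
case: ca => ->; [constructor 1|constructor 2|constructor 3]; split=> //.
- by rewrite subnn.
- by rewrite size_nb subSnn.
- by rewrite def_q /=; lia.
Qed.

Lemma ctx_neq_cons (x : addr * bool) (c : ctx) : (c == x :: c) = false.
Proof. by apply/eqP=> /(congr1 size) /=; lia. Qed.

Lemma color_lt5 u v : okkey v -> link u v -> color u v < 5.
Proof.
rewrite /color => okv [sl | [q [s [def_v co]]]].
  case: (sl) => -> _ _; rewrite eqxx.
  by case: (size_link_same sl) => [[_ ->]|[_ _ ->]]; lia.
rewrite def_v ctx_neq_cons /=.
move: okv; rewrite /okkey /okctx def_v /= => /andP[/andP[/andP[_ okq] _] _].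
by case: (corner_size co okq) => -[_ ->]; case: (q) => //=; lia.
Qed.

Lemma link_klt u v : link u v -> klt u v.
Proof.
rewrite kltE; case=> [sl | [q [s [-> _]]]]; last first.
  by rewrite /clt /shortlex /= ltnSn.
case: (sl) => -> _ _; rewrite eqxx altE.
by case: (size_link_same sl) => [[_ ->]|[_ _ ->]]; rewrite ?ltnS ?leqnn ?leqnSn ?orbT.
Qed.

Definition kle (u v : key) : bool := (u == v) || klt u v.

Lemma kle_ctx u v : clt (kctx u) (kctx v) -> kle u v.
Proof. by rewrite /kle kltE => ->; rewrite orbT. Qed.

Lemma kle_size u v : (kctx u) = (kctx v) -> size (kaddr u) < size (kaddr v) -> kle u v.
Proof. by rewrite /kle kltE altE => -> ->; rewrite eqxx !orbT. Qed.

Lemma kle_cole u v : (kctx u) = (kctx v) -> size (kaddr u) = size (kaddr v) -> cole (kaddr u) (kaddr v) -> kle u v.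
Proof.
case: u v => [c a] [c' a']; rewrite /kle kltE altE /kctx /kaddr /= => -> ->; rewrite !eqxx.
by rewrite xpair_eqE eqxx /= => /orP[]->; rewrite ?orbT.
Qed.

Lemma cole_behead a b : cole a b -> size a = size b -> cole (behead a) (behead b).
Proof.
rewrite /cole; case: a b => [|e a] [|e' b] //=.
by case/orP=> [/eqP[_ ->]|/orP[->|/andP[->]]]; rewrite ?eqxx ?orbT.
Qed.

(** Monotonicity of the lower end in the upper end, within one queue, excludes nesting. Equal
    colours mean equal spans, so the order of components and layers carries over; within a layer,
    span 1 is [around_mono] and span 2 drops two entries. *)
Lemma same_ctx_link_mono u v u' v' : okkey v -> okkey v' ->
  same_ctx_link u v -> same_ctx_link u' v' -> color u v = color u' v' ->
  klt v' v -> kle u' u.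
Proof.
move=> /andP[_ okv] /andP[_ okv'] sl sl'.
have [e nv _] := sl; have [e' nv' _] := sl'; rewrite /color e e' !eqxx => col lt_v.
move: lt_v; rewrite kltE altE => /orP[lt_c | /andP[/eqP ev lt_v]]; first by apply: kle_ctx; rewrite e e'.
case/orP: lt_v => [lt_s | /andP[/eqP sz' lt_v]].
  apply: kle_size; first by rewrite e e'.
  by case: (size_link_same sl) (size_link_same sl') col lt_s => [[_ ->]|[_ _ ->]]
     [[_ ->]|[_ _ ->]]; lia.
have sz : size (kaddr v') = size (kaddr v) := sz'.
have szu : size (kaddr u') = size (kaddr u).
  by case: (size_link_same sl) (size_link_same sl') col sz => [[_ ->]|[_ _ ->]]
     [[_ ->]|[_ _ ->]]; lia.
apply: kle_cole => //; first by rewrite e e'.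
have le_v : cole (kaddr v') (kaddr v) by rewrite /cole lt_v orbT.
case: (size_link_same sl) (size_link_same sl') => [[ar s1]|[g eu s1]] [[ar' s1']|[g' eu' s1']];
  try by lia.
  move: okv okv' lt_v sz ar ar' nv nv'; case: (kaddr v) (kaddr v') => [|x h] [|x' h'] //=.
  move=> /andP[okh okx] /andP[okh' okx'] /orP[lt_h | /andP[/eqP eh lt_x]] [sz] ar ar' _ _.
    exact: (around_mono okh okh' sz lt_h ar ar').
  subst h'; case gh: (isgap h).
    move: okx okx' lt_x; rewrite gh => /eqP-> /eqP->.
    by case: elt_strict_total => ->.
  by move: ar ar'; rewrite /around gh => -> ->; rewrite /cole eqxx.
by rewrite eu eu'; apply: cole_behead; [apply: cole_behead|]; rewrite ?size_behead ?sz.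
Qed.

(** If the top corners lie in different layers, equal offsets put the lower ends in different layers
    too. Otherwise top and bottom corners compare by dropping entries, middle ones by
    [around_mono]. *)
Lemma cross_link_mono u v u' v' : okkey v -> okkey v' ->
  cross_link u v -> cross_link u' v' -> color u v = color u' v' ->
  klt v' v -> kle u' u.
Proof.
move=> /andP[okc _] /andP[okc' _] [q [s [e co]]] [q' [s' [e' co']]].
rewrite /color e e' !ctx_neq_cons /= !add2n => -[col] lt_v.
have {lt_v} : clt (kctx v') (kctx v) || ((kctx v') == (kctx v)).
  by move: lt_v; rewrite kltE => /orP[->//|/andP[/eqP-> _]]; rewrite eqxx orbT.
move: okc okc'; rewrite /okctx e e' /= => /andP[/andP[okq gq] _] /andP[/andP[okq' gq'] _].
have su := corner_size co gq; have su' := corner_size co' gq'.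
have szle : size (kaddr u) <= size q.
  by case: su => -[-> _]; rewrite ?size_nb ?size_behead //; lia.
have szle' : size (kaddr u') <= size q'.
  by case: su' => -[-> _]; rewrite ?size_nb ?size_behead //; lia.
rewrite /clt {1}/shortlex eqseq_cons /=.
case/orP=> [/orP[lt_sz | /andP[/eqP[szc] /orP[lt_c | /andP[/eqP ec]]]] | ].
- by apply: kle_ctx; rewrite /clt /shortlex -ltnS lt_sz.
- by apply: kle_ctx; rewrite /clt /shortlex szc eqxx lt_c orbT.
- rewrite {1}/lexprod /= => lt_qs.
  have [lt_sz | le_sz] := ltnP (size q') (size q).
    by apply: kle_size => //; lia.
  have sz : size q' = size q.
    case/orP: lt_qs => [|/andP[/eqP->] //]; rewrite altE.
    by case/orP=> [|/andP[/eqP]] //; lia.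
  have nil_eq : (q' == [::]) = (q == [::]) by rewrite -!size_eq0 sz.
  have szu : size (kaddr u') = size (kaddr u) by lia.
  apply: kle_cole => //.
  have le_q : cole q' q.
    case/orP: lt_qs => [|/andP[/eqP->] _]; last by rewrite /cole eqxx.
    by rewrite altE sz ltnn eqxx /= /cole => ->; rewrite orbT.
  have [q0 | qn] := eqVneq q [::].
    have q0' : q' = [::] by apply/eqP; rewrite nil_eq q0.
    by case: su su' => -[-> _] [[-> _]|[-> _]|[-> _]]; rewrite q0 q0'.
  move: su su'; rewrite nil_eq -col qn => su su'.
  case: su => -[eu su1]; case: su' => -[eu' su1']; rewrite su1 // in su1'; rewrite eu eu' //.
    move: gq gq' lt_qs; rewrite nil_eq (negbTE qn) /= => gq gq'.
    have okg : okaddr (behead q) by case: (q) okq => //= ? ? /andP[].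
    have okg' : okaddr (behead q') by case: (q') okq' => //= ? ? /andP[].
    have szg : size (behead q') = size (behead q) by rewrite !size_behead sz.
    have ar : around (behead q) (nb s (behead q)) by rewrite /around gq; case: (s); auto.
    have ar' : around (behead q') (nb s' (behead q')) by rewrite /around gq'; case: (s'); auto.
    case/orP=> [lt_q | /andP[/eqP-> /andP[ns ps]]].
      have : cole (behead q') (behead q) by apply: cole_behead.
      case/orP=> [/eqP eg | lt_g]; last exact: (around_mono okg okg' szg lt_g ar ar').
      move: lt_q; rewrite altE sz ltnn eqxx /=.
      case: (q) (q') eg gq gq' okq okq' => [|x h] [|x' h'] //= -> gq _.
      rewrite gq => /andP[_ /eqP->] /andP[_ /eqP->].
      by case: elt_strict_total => irr _ _; rewrite (colex_irr irr) irr andbF.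
    (* Same top corner: the flag [false] selects the left neighbour of the gap and comes first. *)
    rewrite (negbTE ns) ps; have [lo _] := around_le okg ar.
    by move: lo; rewrite ps.
  by apply: cole_behead; [apply: cole_behead|]; rewrite ?size_behead ?sz.
case/andP=> /eqP[eq es] /eqP ec; subst q' s'.
(* Both upper ends lie in the same triangle, where the colour fixes the corner. *)
suff e2 : (kaddr u') = (kaddr u) by apply: kle_cole; rewrite ?e2 // /cole eqxx.
have [q0 | qn] := eqVneq q [::].
  by case: su su' => -[-> _] [[-> _]|[-> _]|[-> _]]; rewrite q0.
move: su su'; rewrite -col qn => su su'.
by case: su => -[eu su1]; case: su' => -[eu' su1']; rewrite su1 // in su1'; rewrite eu eu'.
Qed.

Lemma link_mono u v u' v' : okkey v -> okkey v' -> link u v -> link u' v' ->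
  color u v = color u' v' -> klt v' v -> kle u' u.
Proof.
have low x y : same_ctx_link x y -> color x y < 2.
  move=> sl; case: (sl) => e _ _; rewrite /color e eqxx.
  by case: (size_link_same sl) => [[_ ->]|[_ _ ->]]; lia.
have high x y : cross_link x y -> 2 <= color x y.
  by case=> q [s [e _]]; rewrite /color e ctx_neq_cons.
move=> okv okv' [sl|cl] [sl'|cl'] col.
- exact: same_ctx_link_mono col.
- by move: (low _ _ sl) (high _ _ cl'); rewrite col; lia.
- by move: (high _ _ cl) (low _ _ sl'); rewrite col; lia.
- exact: cross_link_mono col.
Qed.

(** * Faces and stacking *)

(* Runs grow away from place 0, so the sign of a place tells on which side of it
   the run is extended. *)
Definition rightward (g : addr) : bool := if g is e :: _ then (0 < e.2)%R else false.

Definition near (g : addr) : addr := nb (~~ rightward g) g.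
Definition far (g : addr) : addr := nb (rightward g) g.

(* The key whose stacking opened the face in which [k] is to be stacked; it makes
   the keys reserved for new faces fresh. *)
Definition creator (k : key) : key :=
  match k.2 with
  | [::] =>
      if k.1 is (q, s) :: c then
        (c, if s == rightward (behead q) then nb s (behead q) else q)
      else k
  | e :: a =>
      (k.1,
       if isgap a then
         let s := ~~ rightward a in
         if (head mid a == bdry s) && (rightward (nb s (behead a)) == rightward a)
         then behead a else near a
       else if (e.2 == 0)%R then a else mid :: near k.2)
  end.

(* [face_slot U V W k]: a face with corners [U], [V], [W] whose reserved key is
   [k].  According to how many corners lie in the component of the next level,
   the face is flat (0), a bridge face (1), or a gap or far face (2). *)
Inductive face_slot : key -> key -> key -> key -> Prop :=
| FlatFace q s c :
    okctx ((q, s) :: c) -> q != [::] ->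
    face_slot (c, behead (behead q)) (c, nb s (behead q)) (c, q) ((q, s) :: c, [::])
| BridgeFace q s c x y a m :
    okctx ((q, s) :: c) -> corner q s x -> corner q s y ->
    okaddr a -> ~~ isgap a -> 0 < m < 4 ->
    face_slot (c, x) (c, y) ((q, s) :: c, a) ((q, s) :: c, (m, 0%R) :: a)
| GapFace q s c x g :
    okctx ((q, s) :: c) -> corner q s x -> okaddr g -> isgap g ->
    face_slot (c, x) ((q, s) :: c, behead g) ((q, s) :: c, near g) ((q, s) :: c, mid :: g)
| FarFace q s c x g :
    okctx ((q, s) :: c) -> corner q s x -> okaddr g -> isgap g ->
    face_slot (c, x) ((q, s) :: c, behead g) ((q, s) :: c, mid :: g) ((q, s) :: c, far g).

Definition face (t : seq key) (k : key) : Prop :=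
  exists U V W, perm_eq t [:: U; V; W] /\ face_slot U V W k.

Lemma perm_swap23 (T : eqType) (x y z : T) : perm_eq [:: x; y; z] [:: x; z; y].
Proof. by rewrite perm_cons (perm_catC [:: y] [:: z]). Qed.

Lemma face_of_slot U V W k : face_slot U V W k -> face [:: U; V; W] k.
Proof. by exists U, V, W. Qed.

Lemma gapP g : okaddr g -> isgap g ->
  exists e a, [/\ g = e :: a, okaddr a, isgap a = false, okentry a e & odd `|e.2|%N].
Proof.
case: g => //= e a /andP[oka oke] go; exists e, a; split=> //.
  by case: ifP oke => // _ /eqP ee; move: go; rewrite ee.
by case: ifP oke => // _ /eqP ee; move: go; rewrite ee.
Qed.

Lemma nb_step t e a : isgap a = false -> rightward (e :: a) = t ->
  nb t (e :: a) = step t e :: a.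
Proof.
move=> ga /= rt; rewrite ga; case: (e =P bdry t) => // ee.
by move: rt; rewrite ee; case: (t).
Qed.

Lemma rightward_step t e a : (e.2 != 0)%R -> rightward (e :: a) = t ->
  rightward (step t e :: a) = t.
Proof. by rewrite /step /=; case: e => p i /=; case: t; lia. Qed.

Lemma odd_neq0 (i : int) : odd `|i|%N -> (i != 0)%R.
Proof. lia. Qed.

Lemma step_gap t e a : odd `|e.2|%N -> rightward (e :: a) = t ->
  ((step t e).2 == 0)%R = false /\ (step t (step t e) == bdry (~~ t)) = false.
Proof.
by rewrite /step /bdry; case: e => p i; case: t => /=; rewrite xpair_eqE; split; lia.
Qed.

Lemma creator_gap c e g : isgap g -> creator (c, e :: g) =
  (c, if (head mid g == bdry (~~ rightward g))
         && (rightward (nb (~~ rightward g) (behead g)) == rightward g)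
      then behead g else near g).
Proof. by rewrite /creator /= => ->. Qed.

(* The gap of [nb t g] that lies next to [mid :: g]. *)
Lemma outer_gapP t g (g' := bdry (~~ t) :: nb t g) : okaddr g -> isgap g ->
  [/\ okaddr g', isgap g', rightward g' = t, near g' = mid :: g
    & creator ([::], mid :: g')
      = ([::], if rightward g == t then nb t g else mid :: g)].
Proof.
move=> okg gg; have ng : g != [::] by case: (g) gg.
have gn : isgap (nb t g) = false by rewrite isgap_nb // gg.
have nn : nb t g != [::] by rewrite -size_eq0 size_nb size_eq0.
have rt : rightward g' = t by rewrite /g' /=; case: (t).
have nearE : near g' = mid :: g.
  by rewrite /near rt /g' /= gn eqxx nbK.
have gg' : isgap g' by rewrite /g' /=; case: (t).
split=> //.
  by rewrite /g' /= okaddr_nb //= gn /okentry (negbTE nn); case: (t).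
by rewrite creator_gap // rt nearE [head mid g']/= [behead g']/= eqxx nbK.
Qed.

Lemma creator_real c e a : isgap a = false -> (e.2 == 0)%R = false ->
  creator (c, e :: a) = (c, mid :: near (e :: a)).
Proof. by rewrite /creator /= => -> ->. Qed.

Lemma rightward_far g : okaddr g -> isgap g -> rightward (far g) = rightward g.
Proof.
move=> okg gg; have [e [a [def_g oka ga oke odde]]] := gapP okg gg.
have e0 := odd_neq0 odde.
by rewrite /far def_g nb_step // rightward_step.
Qed.

Lemma creator_far c g : okaddr g -> isgap g -> creator (c, far g) = (c, mid :: g).
Proof.
move=> okg gg; have near_far : near (far g) = g.
  by rewrite /near rightward_far // nbK.
have [e [a [def_g oka ga oke odde]]] := gapP okg gg.
have def_f : far g = step (rightward g) e :: a by rewrite /far {2}def_g nb_step // def_g.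
have [sf0 _] := step_gap odde (congr1 rightward (esym def_g)).
by rewrite def_f creator_real // -def_f near_far.
Qed.

Lemma creator_ctx c a : a != [::] -> creator (c, a) = (c, (creator ([::], a)).2).
Proof. by case: a. Qed.

Lemma size_far g : size (far g) = size g.
Proof. exact: size_nb. Qed.

(** A flat face splits into three bridge faces, a bridge face into one bridge and two gap faces, a
    gap face into a far, a flat and a gap face, and a far face into a flat and two gap faces. *)
Lemma face_slot_spawn U V W k : face_slot U V W k ->
  exists k1 k2 k3, [/\ face [:: U; V; k] k1, face [:: V; W; k] k2, face [:: U; W; k] k3,
    uniq [:: k1; k2; k3] & forall k', k' \in [:: k1; k2; k3] -> creator k' = k].
Proof.
case=> {U V W k} [q s c okc nq | q s c x y a m okc cx cy oka ga m14 | q s c x g okc cx okg gg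
                 | q s c x g okc cx okg gg].
- pose C : ctx := (q, s) :: c.
  exists (C, [:: (1, 0%R)]), (C, [:: (2, 0%R)]), (C, [:: (3, 0%R)]).
  have co : [/\ corner q s (behead (behead q)), corner q s (nb s (behead q)) & corner q s q].
    by split; [constructor 3 | constructor 2 | constructor 1].
  case: co => co1 co2 co3; split.
  + by apply: face_of_slot; apply: BridgeFace.
  + by apply: face_of_slot; apply: BridgeFace.
  + by apply: face_of_slot; apply: BridgeFace.
  + by rewrite /= !inE !xpair_eqE !eqseq_cons !xpair_eqE /= !andbF.
  + by move=> k'; rewrite !inE => /or3P[]/eqP->.
- pose C : ctx := (q, s) :: c; pose y' : addr := (m, 0%R) :: a.
  pose gl : addr := (m, (-1)%R) :: a; pose gr : addr := (m, 1%R) :: a.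
  have ga' := negbTE ga.
  have oky : okaddr y' by rewrite /y' /= oka ga' /okentry /=; case: (a == [::]); lia.
  have okl : okaddr gl by rewrite /gl /= oka ga' /okentry /=; case: (a == [::]); lia.
  have okr : okaddr gr by rewrite /gr /= oka ga' /okentry /=; case: (a == [::]); lia.
  have m0 : m != 0 by lia.
  have m4 : m != 4 by lia.
  have nl : near gl = y' by rewrite /near /gl /= ga' xpair_eqE (negbTE m4).
  have nr : near gr = y' by rewrite /near /gr /= ga' xpair_eqE (negbTE m0).
  exists (C, mid :: y'), (C, mid :: gl), (C, mid :: gr); split.
  + by apply: face_of_slot; apply: BridgeFace.
  + by apply: face_of_slot; rewrite -/y' -nl; apply: (@GapFace q s c y gl).
  + by apply: face_of_slot; rewrite -/y' -nr; apply: (@GapFace q s c x gr).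
  + by rewrite /= !inE !xpair_eqE !eqseq_cons !xpair_eqE /= !(andbF, andFb).
  + move=> k'; rewrite !inE => /or3P[]/eqP-> //.
      by rewrite creator_gap // nl /= xpair_eqE (negbTE m4).
    by rewrite creator_gap // nr /= xpair_eqE (negbTE m0).
- pose C : ctx := (q, s) :: c; pose z : addr := mid :: g; pose t := ~~ rightward g.
  pose g' : addr := bdry (~~ t) :: near g.
  have [okg' gg' rg' ng' cg'] := outer_gapP t okg gg.
  have okz : okctx ((z, t) :: C) by rewrite /okctx /= okg gg eqxx.
  exists (C, far g), ((z, t) :: C, [::]), (C, mid :: g'); split.
  + by apply: face_of_slot; apply: FarFace.
  + by apply: face_of_slot; apply: (@FlatFace z t C).
  + exists (c, x), (C, behead g'), (C, near g'); split; first by rewrite ng'.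
    exact: GapFace.
  + rewrite /= !inE !xpair_eqE !negb_or eqxx [C == _]ctx_neq_cons /= andbF /= andbT.
    by apply/eqP=> /(congr1 size); rewrite size_far /= size_nb; lia.
  + move=> k'; rewrite !inE => /or3P[]/eqP->.
    * exact: creator_far.
    * by rewrite /creator /= /t; case: (rightward g).
    * by rewrite creator_ctx // cg' /t; case: (rightward g).
- pose C : ctx := (q, s) :: c; pose z : addr := mid :: g; pose t := rightward g.
  (* [g2] is the next gap of the run beyond the new vertex [f]; [g'] is the outermost child of [f]
     on the side of [g], next to [z]. *)
  pose f := far g; pose g' : addr := bdry (~~ t) :: f; pose g2 := nb t f.
  have [okg' gg' rg' ng' cg'] := outer_gapP t okg gg.
  have okz : okctx ((z, t) :: C) by rewrite /okctx /= okg gg eqxx.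
  have [e [a [def_g oka ga oke odde]]] := gapP okg gg.
  have e0 := odd_neq0 odde.
  have te : rightward (e :: a) = t by rewrite /t def_g.
  have def_f : f = step t e :: a by rewrite /f /far -/t def_g nb_step.
  have tf : rightward (step t e :: a) = t by apply: rightward_step.
  have def_g2 : g2 = step t (step t e) :: a by rewrite /g2 def_f nb_step.
  have [/negbT sf0 nb2] := step_gap odde te.
  have tg2 : rightward g2 = t by rewrite def_g2 rightward_step.
  have okf : okaddr f by apply: okaddr_nb.
  have nf : f != [::] by rewrite def_f.
  have okg2 : okaddr g2 by apply: okaddr_nb.
  have gf : isgap f = false by rewrite /f /far isgap_nb ?gg // def_g.
  have gg2 : isgap g2 by rewrite /g2 isgap_nb ?gf.
  have ng2 : near g2 = f by rewrite /near tg2 /g2 nbK.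
  have bg2 : behead g2 = behead g by rewrite def_g2 def_g.
  exists (C, mid :: g2), ((z, t) :: C, [::]), (C, mid :: g'); split.
  + by apply: face_of_slot; rewrite -/f -ng2 -bg2; apply: (@GapFace q s c x g2).
  + exists (C, behead g), (C, far g), (C, z); split; last exact: (@FlatFace z t C).
    exact: perm_swap23.
  + exists (c, x), (C, behead g'), (C, near g'); split; last exact: GapFace.
    by rewrite ng'; exact: perm_swap23.
  + rewrite /= !inE !xpair_eqE !negb_or eqxx [C == _]ctx_neq_cons /= andbF /= andbT.
    by apply/eqP=> /(congr1 size); rewrite def_g2 /g' def_f => /n_Sn.
  + move=> k'; rewrite !inE => /or3P[]/eqP->.
    * by rewrite creator_gap // tg2 ng2 {1}def_g2 /= nb2.
    * by rewrite /creator /= eqxx.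
    * by rewrite creator_ctx // cg' eqxx.
Qed.

(** * Realizing planar 3-trees *)

Definition linked (u v : key) : Prop := link u v \/ link v u.

Lemma corner_cross_link q s c x a : corner q s x -> linked (c, x) ((q, s) :: c, a).
Proof. by move=> co; left; right; exists q, s. Qed.

Lemma face_slot_link U V W k : face_slot U V W k ->
  okkey k /\ (forall X, X \in [:: U; V; W] -> linked X k).
Proof.
case=> {U V W k} [q s c okc nq | q s c x y a m okc cx cy oka ga m14 | q s c x g okc cx okg gg
                 | q s c x g okc cx okg gg].
- rewrite /okkey okc; split=> // X; rewrite !inE => /or3P[]/eqP->;
    apply: corner_cross_link; [constructor 3 | constructor 2 | constructor 1] => //.
- have ga' := negbTE ga; split.
    by rewrite /okkey okc /= oka ga' /okentry /=; case: (a == [::]); lia.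
  move=> X; rewrite !inE => /or3P[]/eqP->; try exact: corner_cross_link.
  by left; left; split=> //; left; rewrite /around /= ga'.
- split; first by rewrite /okkey okc /= okg gg eqxx.
  move=> X; rewrite !inE => /or3P[]/eqP->; first exact: corner_cross_link.
    by left; left; split=> //; right.
  left; left; split=> //; left; rewrite /around /= gg /near.
  by case: (rightward g); auto.
- split; first by rewrite /okkey okc okaddr_nb.
  have [e [a [def_g oka ga oke odde]]] := gapP okg gg.
  have def_f : far g = step (rightward g) e :: a by rewrite /far {2}def_g nb_step // def_g.
  move=> X; rewrite !inE => /or3P[]/eqP->; first exact: corner_cross_link.
    left; left; split; rewrite //= ?def_f //; left.
    by rewrite /around /kaddr /= ga def_g.
  right; left; split=> //; left; rewrite /around /= gg /far.
  by case: (rightward g); auto.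
Qed.

Lemma perm_eq3 (T : eqType) (x y z u v w : T) : perm_eq [:: x; y; z] [:: u; v; w] ->
  (x, y, z) \in [:: (u, v, w); (u, w, v); (v, u, w); (v, w, u); (w, u, v); (w, v, u)].
Proof.
have p1 (a b : T) : perm_eq [:: a] [:: b] -> a = b.
  by move=> /perm_mem/(_ a); rewrite !inE eqxx => /esym/eqP.
have p2 (a b c d : T) : perm_eq [:: a; b] [:: c; d] -> (a, b) \in [:: (c, d); (d, c)].
  move=> p; have := perm_mem p a; rewrite !inE eqxx => /esym/orP[]/eqP ea; subst a.
    by move: p; rewrite perm_cons => /p1->; rewrite eqxx.
  move: p; rewrite perm_sym (perm_catC [:: c] [:: d]) perm_cons perm_sym => /p1->.
  by rewrite eqxx orbT.
move=> p; have := perm_mem p x; rewrite !inE eqxx => /esym/or3P[]/eqP ex; subst x.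
- by move: p; rewrite perm_cons => /p2; rewrite !inE !xpair_eqE !eqxx => /orP[]->; rewrite ?orbT.
- move: p; rewrite perm_sym (perm_catCA [:: u] [:: v]) perm_cons perm_sym => /p2.
  by rewrite !inE !xpair_eqE !eqxx => /orP[]->; rewrite ?orbT.
- move: p; rewrite perm_sym (perm_catC [:: u; v] [:: w]) perm_cons perm_sym => /p2.
  by rewrite !inE !xpair_eqE !eqxx => /orP[]->; rewrite ?orbT.
Qed.

Lemma face_perm t t' k : perm_eq t t' -> face t' k -> face t k.
Proof. by move=> p [U [V [W [p' fs]]]]; exists U, V, W; rewrite (permPl p). Qed.

Lemma face_link t k : face t k -> okkey k /\ (forall X, X \in t -> linked X k).
Proof.
case=> U [V [W [/perm_mem p /face_slot_link[ok l]]]]; split=> // X.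
by rewrite p; apply: l.
Qed.

Lemma face_spawn X Y Z k : face [:: X; Y; Z] k ->
  exists k1 k2 k3, [/\ face [:: X; Y; k] k1, face [:: Y; Z; k] k2, face [:: X; Z; k] k3,
    uniq [:: k1; k2; k3] & forall k', k' \in [:: k1; k2; k3] -> creator k' = k].
Proof.
case=> U [V [W [/perm_eq3 p /face_slot_spawn[k1 [k2 [k3 [f1 f2 f3 un cr]]]]]]].
have sw A B l : face [:: A; B; k] l -> face [:: B; A; k] l.
  by apply: face_perm; rewrite (perm_catCA [:: B] [:: A]).
have cr' ks : perm_eq ks [:: k1; k2; k3] -> forall k', k' \in ks -> creator k' = k.
  by move=> /perm_mem pk k'; rewrite pk; apply: cr.
have un' ks : perm_eq ks [:: k1; k2; k3] -> uniq ks by move=> /perm_uniq->.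
have P ks : (forall a : pred key, count a ks = count a [:: k1; k2; k3]) ->
  perm_eq ks [:: k1; k2; k3] by move=> H; apply/seq.permP.
move: p; rewrite !inE !xpair_eqE.
by case/or4P=> [/andP[/andP[/eqP-> /eqP->] /eqP->] | /andP[/andP[/eqP-> /eqP->] /eqP->]
  | /andP[/andP[/eqP-> /eqP->] /eqP->] | /or3P[]/andP[/andP[/eqP-> /eqP->] /eqP->]];
 [exists k1, k2, k3 | exists k3, k2, k1 | exists k1, k3, k2 | exists k2, k3, k1
 | exists k3, k1, k2 | exists k2, k1, k3]; split; auto;
 try (apply: un'; apply: P => a /=; move: (a k1) (a k2) (a k3); clear; lia); try (apply: cr'; apply: P => a /=; move: (a k1) (a k2) (a k3); clear; lia).
Qed.

(** [O] holds the occupied keys and [L] pairs each face with its reserved key. The clause on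
    [creator] keeps newly reserved keys distinct from all earlier ones. *)
Definition realizes (n : nat) (adj : rel nat) (F : seq (nat * nat * nat)) : Prop :=
  exists (f : nat -> key) (L : seq ((nat * nat * nat) * key)),
  let O := [seq f x | x <- iota 0 n] in
  [/\ uniq (O ++ unzip2 L), forall k, k \in O ++ unzip2 L -> creator k \in O,
      all okkey O, forall x y, adj x y -> [/\ x < n, y < n & linked (f x) (f y)]
    & perm_eq F (unzip1 L) /\ forall a b c k, ((a, b, c), k) \in L ->
        [/\ a < n, b < n, c < n & face [:: f a; f b; f c] k]].

Lemma linkedC u v : linked u v -> linked v u.
Proof. by case; [right | left]. Qed.

Lemma realizes_base : realizes 3 (tri_adj 0 1 2) [:: (0, 1, 2); (0, 1, 2)].
Proof.
(* Vertex 1 is the root of the component in the degenerate triangle at vertex 0, and vertex 2 is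
   place 0 of run 1; the two faces belong to the gaps at places 1 and -1. *)
pose C : ctx := [:: ([::], false)].
pose f x : key := if x is x'.+1 then (C, if x' is _.+1 then [:: (1, 0%R)] else [::]) else ([::], [::]).
have co : corner [::] false [::] by constructor 1.
exists f, [:: ((0, 1, 2), (C, [:: mid; (1, 1%R)])); ((0, 1, 2), (C, [:: mid; (1, (-1)%R)]))].
have fa : face [:: f 0; f 1; f 2] (C, [:: mid; (1, 1%R)]).
  apply: face_of_slot; exact: (@GapFace [::] false [::] [::] [:: (1, 1%R)]).
split=> //=.
- move=> k; rewrite !inE => /or4P[/eqP-> | /eqP-> | /eqP-> | /orP[]/eqP->] //=.
- have l01 : linked (f 0) (f 1) by exact: corner_cross_link.
  have l02 : linked (f 0) (f 2) by exact: corner_cross_link.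
  have l12 : linked (f 1) (f 2) by left; left; split=> //; left.
  by move=> [|[|[|x]]] [|[|[|y]]]; rewrite /tri_adj /= ?andbF // => _; split=> //; exact: linkedC.
- split=> // a b c k; rewrite !inE !xpair_eqE.
  case/orP=> /andP[/andP[/andP[/eqP-> /eqP->] /eqP->] /eqP->]; split=> //.
  apply: face_of_slot; exact: (@GapFace [::] false [::] [::] [:: (1, (-1)%R)]).
Qed.

Lemma realizes_stack n adj F a b c : realizes n adj F -> (a, b, c) \in F ->
  realizes n.+1 (stack_adj adj n a b c)
    ([:: (a, b, n); (b, c, n); (a, c, n)] ++ rem (a, b, c) F).
Proof.
case=> f [L [un cr ok lk [pF fL]]] abcF.
have /mapP[[t k] kL /= def_t] : (a, b, c) \in unzip1 L by rewrite -(perm_mem pF).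
subst t; have [lta ltb ltc fk] := fL _ _ _ _ kL.
have [okk lk_k] := face_link fk.
have [k1 [k2 [k3 [f1 f2 f3 un3 cr3]]]] := face_spawn fk.
pose f' x := if x == n then k else f x.
have f'n : f' n = k by rewrite /f' eqxx.
have f'E x : x < n -> f' x = f x by rewrite /f'; case: eqP => // ->; rewrite ltnn.
pose O := [seq f x | x <- iota 0 n].
have O'E : [seq f' x | x <- iota 0 n.+1] = rcons O k.
  rewrite -addn1 iotaD map_cat /= f'n cats1; congr rcons.
  by apply/eq_in_map => x; rewrite mem_iota => /f'E.
pose L' := rem ((a, b, c), k) L.
have pL : perm_eq L (((a, b, c), k) :: L') by apply: perm_to_rem.
have pL2 : perm_eq (O ++ unzip2 L) (rcons O k ++ unzip2 L').
  by rewrite cat_rcons perm_cat2l; apply: (perm_map snd pL).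
have kO : k \notin O.
  have : k \in unzip2 L by apply: (map_f snd kL).
  move: un; rewrite cat_uniq => /and3P[_ /hasPn H _] /H.
  by [].
(* Every earlier key has its creator in [O], whereas the creator of [k'] is [k], not yet in [O]. *)
have fresh k' : k' \in [:: k1; k2; k3] -> k' \notin O ++ unzip2 L.
  by move=> /cr3 ck'; apply: contra kO => /cr; rewrite ck'.
exists f', ([:: ((a, b, n), k1); ((b, c, n), k2); ((a, c, n), k3)] ++ L').
move=> O'; rewrite {}/O' O'E; split; rewrite /=.
- have -> : uniq (rcons O k ++ [:: k1, k2, k3 & unzip2 L'])
      = uniq ([:: k1; k2; k3] ++ (rcons O k ++ unzip2 L')).
    by apply: perm_uniq; rewrite (perm_catCA (rcons O k) [:: k1; k2; k3]).
  rewrite cat_uniq un3 -(perm_uniq pL2) un andbT /=.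
  apply/hasPn => k'; rewrite -(perm_mem pL2) => k'OL.
  by apply: contraL k'OL; apply: fresh.
- move=> k'; rewrite mem_rcons inE.
  have -> : (k' \in rcons O k ++ [:: k1, k2, k3 & unzip2 L'])
      = (k' \in [:: k1; k2; k3] ++ (rcons O k ++ unzip2 L')).
    by apply: perm_mem; rewrite (perm_catCA (rcons O k) [:: k1; k2; k3]).
  rewrite mem_cat -(perm_mem pL2) => /orP[/cr3-> | /cr->]; rewrite ?eqxx ?orbT //.
- by rewrite all_rcons okk.
- have abc_lt x : x \in [:: a; b; c] -> x < n.
    by rewrite !inE => /or3P[]/eqP->.
  have lkn x : x \in [:: a; b; c] -> linked (f' x) k.
    move=> xabc; rewrite f'E ?abc_lt //; apply: lk_k.
    by move: xabc; rewrite !inE => /or3P[]/eqP->; rewrite eqxx ?orbT.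
  move=> x y /or3P[/lk[ltx lty lxy] | /andP[/eqP-> yabc] | /andP[/eqP-> xabc]].
  + by rewrite !f'E // !ltnS !(ltnW ltx, ltnW lty).
  + by rewrite f'n ltnSn ltnS ltnW ?abc_lt //; split=> //; apply/linkedC/lkn.
  + by rewrite f'n ltnSn ltnS ltnW ?abc_lt //; split=> //; apply/lkn.
- split.
    rewrite !perm_cons.
    have p1 : perm_eq F ((a, b, c) :: unzip1 L') by rewrite (permPl pF); apply: (perm_map fst pL).
    by rewrite -(perm_cons (a, b, c)) -(permPl (perm_to_rem abcF)).
  move=> a' b' c' k'; rewrite !inE !xpair_eqE.
  case/or4P=> [/andP[/andP[/andP[/eqP-> /eqP->] /eqP->] /eqP->]
    | /andP[/andP[/andP[/eqP-> /eqP->] /eqP->] /eqP->]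
    | /andP[/andP[/andP[/eqP-> /eqP->] /eqP->] /eqP->] | /mem_rem/fL[la lb lc fa]];
  by rewrite ?f'n ?f'E //; split=> //; apply: ltnW.
Qed.

Lemma planar3tree_realizes n adj F : planar3tree n adj F -> realizes n adj F.
Proof.
elim=> [|m adj' F' a b c _ IH abc]; first exact: realizes_base.
exact: realizes_stack IH abc.
Qed.

(** * From realizations to queue layouts *)

Lemma strict_total_rank n (lt : rel 'I_n) : strict_total lt ->
  exists sigma : {perm 'I_n}, forall x y, (sigma x < sigma y) = lt x y.
Proof.
(* The position of an element is the number of elements below it. *)
move=> [irr tr tot]; pose rk x := #|[pred z | lt z x]|.
have rk_lt x y : lt x y -> rk x < rk y.
  move=> xy; apply: proper_card; apply/properP; split.
    by apply/subsetP => z; rewrite !inE => zx; apply: tr zx xy.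
  by exists x; rewrite !inE ?irr.
have rk_bound x : rk x < n.
  rewrite -[n in _ < n]card_ord; apply: proper_card; apply/properP; split.
    exact/subsetP.
  by exists x; rewrite ?inE ?irr.
have rk_inj : injective (fun x => Ordinal (rk_bound x)).
  move=> x y [exy]; apply/eqP/negPn/negP => /tot/orP[]/rk_lt; by rewrite exy ltnn.
exists (perm rk_inj) => x y; rewrite !permE /=.
have [-> | /tot/orP[]xy] := eqVneq x y; first by rewrite irr ltnn.
  by rewrite xy rk_lt.
have /ltnW := rk_lt _ _ xy; rewrite leqNgt => /negbTE->.
by apply/esym/negP=> /(tr _ _ _ xy); rewrite irr.
Qed.

Theorem mainTheorem1 (n : nat) (adj : rel nat) (F : seq (nat * nat * nat)) :
  planar3tree n adj F -> queue_number_le n adj 5.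
Proof.
case/planar3tree_realizes=> f [L [un _ ok lk _]].
have [irr tr tot] := klt_strict_total.
have okf (x : 'I_n) : okkey (f x).
  by apply: (allP ok); apply: map_f; rewrite mem_iota ltn_ord.
have f_inj : injective (fun x : 'I_n => f x).
  move=> x y exy; apply: val_inj.
  move: un; rewrite cat_uniq => /andP[/(uniqP (f 0)) inj _].
  have fnth (z : 'I_n) : nth (f 0) [seq f x | x <- iota 0 n] z = f z.
    by rewrite (nth_map 0) ?size_iota ?nth_iota.
  apply: inj; rewrite ?inE ?size_map ?size_iota ?ltn_ord //.
  exact: etrans (fnth x) (etrans exy (esym (fnth y))).
have [sigma sigmaE] : exists sigma : {perm 'I_n}, forall x y, (sigma x < sigma y) = klt (f x) (f y).
  apply: strict_total_rank; split=> [x | y x z | x y xy]; [exact: irr | exact: tr |].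
  by apply: tot; apply: contra xy => /eqP/f_inj->.
(* Orienting each pair upwards along [sigma] makes the colour symmetric; [inord] is faithful on
   edges, whose colours are below 5. *)
exists sigma, (fun x y => inord (if sigma x < sigma y then color (f x) (f y)
                                  else color (f y) (f x))); split.
  move=> x y _; congr inord; have [-> // | xy] := eqVneq x y.
  have : (sigma x : nat) != sigma y by rewrite (inj_eq val_inj) (inj_eq perm_inj).
  by case: ltngtP.
have dir (s t : 'I_n) : adj s t -> sigma s < sigma t -> link (f s) (f t).
  move=> /lk[_ _ [] //] /link_klt ts; rewrite sigmaE => st.
  by move: (tr _ _ _ st ts); rewrite irr.
(* The inner edge would have the earlier upper end, so by [link_mono] its lower end could not come
   later. *)
have flat (s1 t1 s2 t2 : 'I_n) : adj s1 t1 -> adj s2 t2 -> sigma s1 < sigma t1 -> sigma s2 < sigma t2 ->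
    color (f s1) (f t1) = color (f s2) (f t2) ->
    ~ (sigma s1 < sigma s2 < sigma t2) && (sigma t2 < sigma t1).
  move=> a1 a2 lt1 lt2 col /andP[/andP[s12 _] t21].
  have := link_mono (okf t1) (okf t2) (dir _ _ a1 lt1) (dir _ _ a2 lt2) col.
  rewrite -sigmaE => /(_ t21)/orP[/eqP/f_inj es | ]; first by move: s12; rewrite es ltnn.
  by rewrite -sigmaE ltnNge ltnW.
move=> s1 t1 s2 t2 a1 a2 lt1 lt2 _; rewrite lt1 lt2 => /(congr1 val)/=.
rewrite !inordK; try (apply: color_lt5 => //; exact: dir).
by move=> col [|]; apply: flat.
Qed.
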